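(* Let $K$ be a field of characteristic zero and let $q\in K$ be nonzero and not a root of unity (for instance, $q$ an indeterminate and $K=\mathbb{Q}(q)$). For all integers $n\ge 1$ and $m\ge 1$, $$ \sum_{1\le k\le n}\genfrac{[}{]}{0pt}{}{n}{k}_q(-1)^{k-1}q^{-kn+\binom k2}\sum_{1\le i_1\le i_2\le\dots\le i_m=k}\frac{q^{i_1}}{1-q^{i_1}}\cdots\frac{q^{i_m}}{1-q^{i_m}}=\sum_{1\le k\le n}\frac{q^{k(m-1)}}{(1-q^k)^m}. $$ Here, for each $k$, the inner sum runs over all $m$-tuples of integers $(i_1,\dots,i_m)$ with $1\le i_1\le i_2\le\dots\le i_m$ and $i_m=k$.
   Context: For $0\le k\le n$, $\genfrac{[}{]}{0pt}{}{n}{k}_q$ denotes the Gaussian polynomial ($q$-binomial coefficient) $$\genfrac{[}{]}{0pt}{}{n}{k}_q=\frac{(q;q)_n}{(q;q)_k(q;q)_{n-k}},\qquad (x;q)_n:=(1-x)(1-xq)\cdots(1-xq^{n-1}),\quad (x;q)_0=1.$$ $\binom k2=k(k-1)/2$ is the ordinary binomial coefficient. *)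

(* Defs.v *)
From mathcomp Require Import all_boot all_algebra.
Set Implicit Arguments.
Unset Strict Implicit.
Unset Printing Implicit Defensive.
Import GRing.Theory.
Local Open Scope ring_scope.

(* (x; q)_n *)
Definition qpoch (K : fieldType) (x q : K) (n : nat) : K :=
  \prod_(j < n) (1 - x * q ^+ j).

(* Only meaningful for k <= n: the subtraction n - k is truncated. *)
Definition qbinom (K : fieldType) (q : K) (n k : nat) : K :=
  qpoch q q n / (qpoch q q k * qpoch q q (n - k)).

(* 1 <= i_1 <= ... <= i_m = k.  The default value of [last] is irrelevant when
   m >= 1.  Since i_m = k bounds every entry, ranging over m.-tuple 'I_k.+1
   misses no such sequence. *)
Definition weak_chain (m k : nat) (i : m.-tuple 'I_k.+1) : bool :=
  let s := [seq nat_of_ord j | j <- i] in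
  [&& all (leq 1) s, sorted leq s & last 0%N s == k].

Definition chain_sum (K : fieldType) (q : K) (m k : nat) : K :=
  \sum_(i : m.-tuple 'I_k.+1 | weak_chain i)
    \prod_(j < m) (q ^+ tnth i j / (1 - q ^+ tnth i j)).

(* Main.v *)
(** Write x_k = q^k / (1 - q^k) and let t(n, k) be the difference between the
    coefficients of the k-th chain sum on the left for n and for n - 1.  By the
    q-Pascal rule, t(n, k) = (-1)^(k-1) q^(C(k,2) - kn) [n-1, k-1]_q, and the
    other q-Pascal rule gives x_k t(n, k) = x_n (t(n, k) - t(n, k+1)).  The
    chain sums c_m satisfy c_(m+1)(k) = x_k (c_m(1) + ... + c_m(k)), so summation
    by parts yields sum_k t(n, k) c_(m+1)(k) = x_n sum_k t(n, k) c_m(k).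
    Hence sum_k t(n, k) c_m(k) = x_n^m / q^n, the n-th term on the right. *)
Require Import Defs.
From mathcomp Require Import all_boot all_algebra.
From mathcomp Require Import ring.
Set Implicit Arguments.
Unset Strict Implicit.
Unset Printing Implicit Defensive.
Import GRing.Theory.
Local Open Scope ring_scope.

Definition qfrac (K : fieldType) (q : K) (k : nat) : K := q ^+ k / (1 - q ^+ k).

(* The default value 1 of [last] makes the chain sum for m = 0 equal to 1 at
   k = 1 and to 0 elsewhere, so that the recurrence in m also holds from m = 0.
   The bound N does not depend on k because the recurrence mixes different k. *)
Definition bounded_chain (N m k : nat) (t : m.-tuple 'I_N) : bool :=
  let s := [seq nat_of_ord j | j <- t] in
  [&& all (leq 1) s, sorted leq s & last 1%N s == k].

Definition bounded_chain_sum (K : fieldType) (q : K) (N m k : nat) : K :=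
  \sum_(t : m.-tuple 'I_N | bounded_chain k t) \prod_(j <- t) qfrac q j.

(** [P] and [F] take sequences so that they apply to tuples of both lengths. *)
Lemma sum_tuple_rcons (V : nmodType) (T : finType) (m : nat)
    (P : pred (seq T)) (F : seq T -> V) :
  \sum_(t : m.+1.-tuple T | P t) F t
  = \sum_(a : T) \sum_(t : m.-tuple T | P (rcons t a)) F (rcons t a).
Proof.
rewrite pair_big_dep /=.
rewrite (reindex (fun p : T * m.-tuple T => [tuple of rcons p.2 p.1])) //=.
exists (fun t => (tnth t ord_max, [tuple of belast (thead t) (behead t)])).
  move=> [a t] _ /=; congr (_, _).
    by rewrite (tnth_nth a) /= nth_rcons size_tuple ltnn eqxx.
  apply: val_inj => /=; rewrite /thead (tnth_nth a) /=.
  by case: t => [[|b s] hs] //=; rewrite belast_rcons.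
move=> t _; apply: val_inj => /=.
case/tupleP: t => b t; rewrite theadE /= (tnth_nth b) /=.
by rewrite -[X in nth _ _ X](size_tuple t) (nth_last b (b :: t)) /= -lastI.
Qed.

(** Removing the final entry k leaves a chain whose own last entry j can be anything from 1 to k. *)
Lemma bounded_chain_sumS (K : fieldType) (q : K) (N m k : nat) :
  (0 < k < N)%N ->
  bounded_chain_sum q N m.+1 k
  = qfrac q k * \sum_(1 <= j < k.+1) bounded_chain_sum q N m j.
Proof.
case/andP=> k_gt0 ltkN; rewrite /bounded_chain_sum /bounded_chain.
rewrite (sum_tuple_rcons m (fun s : seq 'I_N => let u := map val s in
  [&& all (leq 1) u, sorted leq u & last 1%N u == k])
  (fun s => \prod_(j <- s) qfrac q j)) /=.
have chain_rcons (a : 'I_N) (t : m.-tuple 'I_N) :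
  [&& all (leq 1) (map val (rcons t a)), sorted leq (map val (rcons t a))
    & last 1%N (map val (rcons t a)) == k] =
  (a == Ordinal ltkN) && [&& all (leq 1) (map val t), sorted leq (map val t)
     & (0 < last 1%N (map val t) < k.+1)%N].
  rewrite /= map_rcons all_rcons last_rcons -val_eqE /= ltnS.
  case: (val a =P k) => [->|_]; last by rewrite !andbF.
  rewrite k_gt0 andbT /=.
  case: (map _ t) => [|b u] /=; first by rewrite k_gt0.
  rewrite rcons_path; case: (boolP (0 < b)%N) => //= b0.
  case: (boolP (all _ u)) => //= hu; case: path => //=.
  suff -> : (0 < last b u)%N by [].
  by have /allP := hu; have := mem_last b u; rewrite inE => /orP[/eqP->|/[swap]h/h].
rewrite (bigD1 (Ordinal ltkN)) //= [X in _ + X]big1 ?addr0; last first.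
  by move=> a /negPf ne; rewrite big_pred0 // => t; rewrite chain_rcons ne.
under eq_bigl => t do rewrite chain_rcons eqxx /=.
rewrite mulr_sumr.
under [RHS]eq_bigr => j _ do rewrite mulr_sumr.
(* A sum over j concentrated at the last entry of [t] is inserted; exchanging the two sums then
   groups the chains by that entry. *)
transitivity (\sum_(t : m.-tuple 'I_N
      | all (leq 1) (map val t) && sorted leq (map val t))
    \sum_(1 <= j < k.+1 | j == last 1%N (map val t))
      qfrac q k * \prod_(i <- t) qfrac q i).
  under [RHS]eq_bigr => t _ do rewrite big_nat1_eq.
  rewrite -big_mkcondr /=; apply: eq_big => [t|t _]; first by rewrite andbA.
  by rewrite big_rcons /= mulrC.
rewrite (exchange_big_dep xpredT) //=; apply: eq_bigr => j _.
by apply: eq_bigl => t; rewrite -andbA [j == _]eq_sym.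
Qed.

(* Indexed from 0: [iterated_chain q m i] is the chain sum ending at i + 1, and
   likewise [qcoef q n i] and [qcoef_diff q n i] below refer to k = i + 1. *)
Fixpoint iterated_chain (K : fieldType) (q : K) (m i : nat) : K :=
  if m is m'.+1 then qfrac q i.+1 * \sum_(j < i.+1) iterated_chain q m' j
  else (i == 0%N)%:R.

Lemma bounded_chain_sumE (K : fieldType) (q : K) (N m i : nat) :
  (i.+1 < N)%N -> bounded_chain_sum q N m i.+1 = iterated_chain q m i.
Proof.
elim: m i => [|m IH] i ltiN.
  rewrite /bounded_chain_sum /bounded_chain /=.
  case: i ltiN => [|i] _; last by rewrite big_pred0 // => t; rewrite tuple0.
  rewrite (big_pred1 [tuple]) ?big_nil // => t.
  by rewrite /pred1 [t]tuple0 /= eqxx.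
rewrite bounded_chain_sumS ?ltiN // big_add1 /= big_mkord.
congr (_ * _); apply: eq_bigr => j _; apply: IH.
by apply: leq_ltn_trans ltiN; rewrite ltn_ord.
Qed.

Lemma chain_sumE (K : fieldType) (q : K) (m i : nat) :
  chain_sum q m.+1 i.+1 = iterated_chain q m.+1 i.
Proof.
(* With N = i.+2 both sums range over the same tuple type, and a nonempty tuple never reaches the
   default of [last]. *)
rewrite -(bounded_chain_sumE q (N := i.+2)) //; apply: eq_big => t.
  by rewrite /weak_chain /bounded_chain; case/tupleP: t.
by rewrite big_tuple.
Qed.

Lemma one_sub_expr_neq0 (K : fieldType) (q : K) (k : nat) :
  (forall d, (0 < d)%N -> ~~ d.-unity_root q) ->
  (0 < k)%N -> 1 - q ^+ k != 0.
Proof. by move=> hq k0; rewrite subr_eq0 eq_sym -unity_rootE hq. Qed.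

Lemma qpochS (K : fieldType) (q : K) (n : nat) :
  qpoch q q n.+1 = qpoch q q n * (1 - q ^+ n.+1).
Proof. by rewrite /qpoch big_ord_recr /= exprS. Qed.

Lemma qpoch_neq0 (K : fieldType) (q : K) (n : nat) :
  (forall d, (0 < d)%N -> ~~ d.-unity_root q) -> qpoch q q n != 0.
Proof.
move=> hq; apply/prodf_neq0 => j _.
by rewrite -exprS one_sub_expr_neq0.
Qed.

Lemma qbinomE (K : fieldType) (q : K) (n k l : nat) : n = (k + l)%N ->
  qbinom q n k = qpoch q q n / (qpoch q q k * qpoch q q l).
Proof. by move=> ->; rewrite /qbinom addKn. Qed.

Lemma qbinomnn (K : fieldType) (q : K) (n : nat) :
  (forall d, (0 < d)%N -> ~~ d.-unity_root q) -> qbinom q n n = 1.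
Proof.
move=> hq; rewrite /qbinom subnn /qpoch big_ord0 mulr1.
by rewrite divff // qpoch_neq0.
Qed.

(** With n = k + 1 + l, clearing denominators leaves 1 - q^(k+l+2) = (1 - q^(k+1)) + q^(k+1) (1 -
    q^(l+1)). *)
Lemma qbinomSS (K : fieldType) (q : K) (k n : nat) :
  (forall d, (0 < d)%N -> ~~ d.-unity_root q) -> (k < n)%N ->
  qbinom q n.+1 k.+1 = qbinom q n k + q ^+ k.+1 * qbinom q n k.+1.
Proof.
move=> hq /subnKC; move: (n - k.+1)%N => l <-.
rewrite (qbinomE q (esym (addnS k.+1 l))) (qbinomE q (addSnnS k l)).
rewrite (qbinomE q (erefl (k.+1 + l)%N)) (qpochS q (k.+1 + l)) -addnS exprD.
rewrite (qpochS q k) (qpochS q l).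
have P0 j := qpoch_neq0 j hq; have Q0 j := one_sub_expr_neq0 hq (ltn0Sn j).
by field; rewrite !P0 !Q0.
Qed.

Lemma qbinom_ratio (K : fieldType) (q : K) (k n : nat) :
  (forall d, (0 < d)%N -> ~~ d.-unity_root q) -> (k < n)%N ->
  (1 - q ^+ k.+1) * qbinom q n k.+1 = (1 - q ^+ (n - k)) * qbinom q n k.
Proof.
move=> hq /subnKC; move: (n - k.+1)%N => l <-.
rewrite (qbinomE q (addSnnS k l)) (qbinomE q (erefl (k.+1 + l)%N)).
have -> : (k.+1 + l - k = l.+1)%N by rewrite addSnnS addKn.
rewrite (qpochS q k) (qpochS q l).
have P0 j := qpoch_neq0 j hq; have Q0 j := one_sub_expr_neq0 hq (ltn0Sn j).
by field; rewrite !P0 !Q0.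
Qed.

Definition qcoef (K : fieldType) (q : K) (n i : nat) : K :=
  qbinom q n i.+1 * (-1) ^+ i * q ^ (- (i.+1 * n)%:Z + 'C(i.+1, 2)%:Z).

(* t(n + 1, i + 1) *)
Definition qcoef_diff (K : fieldType) (q : K) (n i : nat) : K :=
  (-1) ^+ i * q ^+ 'C(i.+1, 2) / q ^+ (i.+1 * n.+1) * qbinom q n i.

Lemma qcoefE (K : fieldType) (q : K) (n i : nat) : q != 0 ->
  qcoef q n i = qbinom q n i.+1 * (-1) ^+ i * q ^+ 'C(i.+1, 2) / q ^+ (i.+1 * n).
Proof. by move=> q0; rewrite /qcoef expfzDr // -exprnN -exprnP; ring. Qed.

Lemma qcoefS (K : fieldType) (q : K) (n i : nat) : q != 0 ->
  (forall d, (0 < d)%N -> ~~ d.-unity_root q) -> (i < n)%N ->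
  qcoef q n.+1 i = qcoef q n i + qcoef_diff q n i.
Proof.
move=> q0 hq ltin; rewrite !qcoefE // /qcoef_diff qbinomSS // mulnS exprD.
by field; rewrite !expf_neq0.
Qed.

(** The top coefficient is separate: truncated subtraction makes [qbinom q n n.+1] nonzero, so
    [qcoef q n n] is not the 0 that the difference calls for. *)
Lemma qcoef_nn (K : fieldType) (q : K) (n : nat) :
  q != 0 -> (forall d, (0 < d)%N -> ~~ d.-unity_root q) ->
  qcoef q n.+1 n = qcoef_diff q n n.
Proof. by move=> q0 hq; rewrite qcoefE // /qcoef_diff !qbinomnn //; ring. Qed.

(** The ratio of [qcoef_diff] at i + 1 to its value at i is -q^(i-n) (1 - q^(n-i)) / (1 - q^(i+1)).
    Subtracted from 1, it gives q^(i-n) (1 - q^(n+1)) / (1 - q^(i+1)), which is x_(i+1) /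
    x_(n+1). *)
Lemma qcoef_diff_telescope (K : fieldType) (q : K) (n i : nat) : q != 0 ->
  (forall d, (0 < d)%N -> ~~ d.-unity_root q) -> (i < n)%N ->
  qcoef_diff q n i * qfrac q i.+1
  = qfrac q n.+1 * (qcoef_diff q n i - qcoef_diff q n i.+1).
Proof.
move=> q0 hq ltin; rewrite /qcoef_diff /qfrac.
have Q0 j := one_sub_expr_neq0 hq (ltn0Sn j).
have -> : qbinom q n i.+1 = (1 - q ^+ (n - i)) / (1 - q ^+ i.+1) * qbinom q n i.
  by rewrite mulrAC -qbinom_ratio // mulrAC divff ?mul1r.
rewrite (binS i.+1) bin1 (mulSn i.+1) !exprD [(-1) ^+ i.+1]exprS.
(* This leaves q^(i+1) and q^(n-i) as the independent powers for [field]. *)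
move: (Q0 n); have -> : q ^+ n.+1 = q ^+ i.+1 * q ^+ (n - i).
  by rewrite -exprD addSn subnKC // ltnW.
by move=> Qn; field; rewrite Qn Q0 !expf_neq0.
Qed.

Lemma qcoef_diff_partial (K : fieldType) (q : K) (c : nat -> K) (n p : nat) :
  q != 0 -> (forall d, (0 < d)%N -> ~~ d.-unity_root q) -> (p <= n)%N ->
  \sum_(i < p) qcoef_diff q n i * (qfrac q i.+1 * \sum_(j < i.+1) c j)
  = qfrac q n.+1 *
    (\sum_(i < p) qcoef_diff q n i * c i - qcoef_diff q n p * \sum_(j < p) c j).
Proof.
move=> q0 hq; elim: p => [|p IH] lepn.
  by rewrite !big_ord0 mulr0 subr0 mulr0.
rewrite [LHS]big_ord_recr IH ?(ltnW lepn) //= mulrA qcoef_diff_telescope //.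
by rewrite !big_ord_recr /=; ring.
Qed.

(** Summation by parts stops at p = n, where telescoping ends. In the last term i = n the factor
    x_(i+1) is already x_(n+1), and its part with j < n cancels the boundary term. *)
Lemma qcoef_diff_chain (K : fieldType) (q : K) (c : nat -> K) (n : nat) :
  q != 0 -> (forall d, (0 < d)%N -> ~~ d.-unity_root q) ->
  \sum_(i < n.+1) qcoef_diff q n i * (qfrac q i.+1 * \sum_(j < i.+1) c j)
  = qfrac q n.+1 * \sum_(i < n.+1) qcoef_diff q n i * c i.
Proof.
move=> q0 hq; rewrite [LHS]big_ord_recr qcoef_diff_partial //=.
by rewrite !big_ord_recr /=; ring.
Qed.

Lemma qcoef_diff_iterated (K : fieldType) (q : K) (m n : nat) :
  q != 0 -> (forall d, (0 < d)%N -> ~~ d.-unity_root q) ->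
  \sum_(i < n.+1) qcoef_diff q n i * iterated_chain q m i
  = qfrac q n.+1 ^+ m / q ^+ n.+1.
Proof.
move=> q0 hq; elim: m => [|m IH] /=; last first.
  by rewrite qcoef_diff_chain // IH mulrA -exprS.
(* For m = 0 only i = 0 survives, contributing 1 / q^(n+1). *)
rewrite big_ord_recl big1 ?addr0 => [|i _]; last by rewrite mulr0.
rewrite /qcoef_diff /qbinom subn0 /qpoch big_ord0 !mul1r divff ?mulr1 ?mul1n //.
exact: qpoch_neq0.
Qed.

Lemma qcoef_sum (K : fieldType) (q : K) (c : nat -> K) (n : nat) :
  q != 0 -> (forall d, (0 < d)%N -> ~~ d.-unity_root q) ->
  \sum_(i < n) qcoef q n i * c i
  = \sum_(k < n) \sum_(i < k.+1) qcoef_diff q k i * c i.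
Proof.
move=> q0 hq; elim: n => [|n IH]; first by rewrite !big_ord0.
rewrite big_ord_recr [RHS]big_ord_recr -IH /= qcoef_nn // [in RHS]big_ord_recr /=.
rewrite addrA -big_split /=; congr (_ + _); apply: eq_bigr => i _.
by rewrite qcoefS // mulrDl.
Qed.

Theorem theorem1 (K : fieldType) (charK : [pchar K] =i pred0) (q : K)
    (q_neq0 : q != 0)
    (q_nroot : forall d : nat, (0 < d)%N -> ~~ d.-unity_root q)
    (n m : nat) (n_gt0 : (1 <= n)%N) (m_gt0 : (1 <= m)%N) :
  \sum_(1 <= k < n.+1)
     qbinom q n k * (-1) ^+ (k - 1) * q ^ (- (k * n)%:Z + 'C(k, 2)%:Z)
       * chain_sum q m k
  = \sum_(1 <= k < n.+1) q ^+ (k * (m - 1)) / (1 - q ^+ k) ^+ m.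
Proof.
case: m m_gt0 => // m _; rewrite !big_add1 /= !big_mkord.
under eq_bigr => i _ do rewrite chain_sumE subSS subn0 -/(qcoef q n i).
rewrite (qcoef_sum (iterated_chain q m.+1)) //; apply: eq_bigr => k _.
(* Dividing by q^(k+1) cancels one of the m + 1 such factors in the numerator of x_(k+1)^(m+1). *)
rewrite qcoef_diff_iterated // subn1 /= /qfrac expr_div_n exprS exprM.
by rewrite mulrAC [_ * _ ^+ m]mulrC mulfK ?expf_neq0.
Qed.
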